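(* Let $q$ be a positive integer, fix $d>1/2$, and let $N$ be such that $N+1=dq$. Fix $p\in(0,1)$ and consider the random Bernoulli quota complex on the $N+1$ vertices $v_0,\dots,v_N$ with quota $q$ and Bernoulli probability $p$. Then the sequence $m\mapsto \mathbb{E}[\widetilde{\beta}_{m}]$ (for $m=0,1,2,\dots$) is unimodal in $m$.
   Context: Quota complex: given vertices with weights $w(v)>0$ and a quota $q>0$, the quota complex is the simplicial complex on these vertices in which a face $F=[v_{i_0},\dots,v_{i_n}]$ is included if and only if $w(F):=\sum_{k=0}^n w(v_{i_k})<q$. Random Bernoulli quota complex: let $X_1,\dots,X_N$ be i.i.d. Bernoulli random variables with $\mathbb{P}[X_j=1]=p$ and $\mathbb{P}[X_j=0]=1-p$; vertex $v_0$ has fixed weight $W_0=1$ and vertex $v_j$ has weight $W_j=1+X_j$ for $j=1,\dots,N$ (so all weights are $1$ or $2$); the complex is the quota complex with these weights and quota $q$. $\widetilde{\beta}_m$ denotes the reduced $m$-th Betti number of this complex with real coefficients, i.e. $\dim \widetilde{H}_m(X;\mathbb{R})$. A sequence of nonnegative reals is unimodal if it is (weakly) increasing up to some index and (weakly) decreasing afterwards. *)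

(* Defs.v *)
From HB Require Import structures.
From mathcomp Require Import all_boot all_order all_algebra.
From mathcomp Require Import all_classical all_reals all_analysis.

Set Implicit Arguments.
Unset Strict Implicit.
Unset Printing Implicit Defensive.

Import Order.TTheory GRing.Theory Num.Theory.
Local Open Scope ring_scope.

Section SimplicialHomology.
Variables (R : realType) (n : nat).

(* A complex on the vertex set 'I_n is the set of its faces, including the
   empty face, of dimension -1, as required by reduced homology. *)
Implicit Types (F : {set 'I_n}) (K : {set {set 'I_n}}).

Definition is_complex K :=
  finset.set0 \in K /\
  (forall F G : {set 'I_n}, F \in K -> G \subset F -> G \in K).

(* Formal real combinations of all vertex sets, oriented by the order of 'I_n;
   the chains of a given complex span subspaces of this space. *)
Definition chain := {ffun {set 'I_n} -> R^o}.

Definition face_chain F : chain := [ffun G => (G == F)%:R].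

(* The vertex v has position #|[set u in F | u < v]| in F, so this is
   d[v_0, .., v_m] = \sum_i (-1)^i [v_0, .., v_(i-1), v_(i+1), .., v_m];
   in particular d[v] is the empty face, i.e., the augmentation. *)
Definition boundary_face F : chain :=
  \sum_(v in F)
    (-1) ^+ #|[set u in F | (u < v)%N]%SET| *: face_chain (F :\ v).

Definition boundary_fun (c : chain) : chain :=
  \sum_(F : {set 'I_n}) (c F : R) *: boundary_face F.

Fact boundary_fun_is_linear : linear boundary_fun.
Proof.
move=> a c c'; rewrite /boundary_fun scaler_sumr -big_split /=.
by apply: eq_bigr => F _; rewrite !ffunE scalerDl scalerA.
Qed.

HB.instance Definition _ :=
  GRing.isLinear.Build R chain chain _ boundary_fun boundary_fun_is_linear.

Definition boundary : 'End(chain) := linfun boundary_fun.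

Fact boundary_face_chain F : boundary (face_chain F) = boundary_face F.
Proof.
rewrite lfunE /= /boundary_fun (bigD1 F) //= ffunE eqxx scale1r big1 ?addr0 //.
by move=> G /negPf GF; rewrite ffunE GF scale0r.
Qed.

Fact boundaryK F : boundary (boundary_face F) = 0.
Proof.
pose pos (G : {set 'I_n}) (v : 'I_n) := #|[set u in G | (u < v)%N]%SET|.
pose e v u : chain :=
  (-1) ^+ (pos F v + pos (F :\ v) u) *: face_chain (F :\ v :\ u).
have -> : boundary (boundary_face F) =
    \sum_(v in F) \sum_(u in F | u != v) e v u.
  rewrite linear_sum; apply: eq_bigr => v _.
  rewrite linearZ /= boundary_face_chain scaler_sumr.
  apply: eq_big => [u|u _]; first by rewrite !inE andbC.
  by rewrite scalerA -exprD.
have eC (v u : 'I_n) : v \in F -> (u < v)%N -> u \in F -> e v u = - e u v.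
  move=> vF uv uF.
  rewrite /e -scaleNr finset.setDDl finset.setUC -finset.setDDl.
  congr (_ *: _).
  have -> : pos (F :\ v) u = pos F u.
    apply: eq_card => x; rewrite !inE.
    by case: eqVneq => //= ->; rewrite ltnNge (ltnW uv) andbF.
  have -> : pos F v = (pos (F :\ u) v).+1.
    rewrite /pos (cardsD1 u) !inE uF uv add1n; congr _.+1.
    by apply: eq_card => x; rewrite !inE andbA.
  by rewrite addSn exprS mulN1r addnC.
pose s := \sum_(v in F) \sum_(u in F | (u < v)%N) e v u.
transitivity (s + \sum_(v in F) \sum_(u in F | (v < u)%N) e v u).
  rewrite -big_split; apply: eq_bigr => v vF /=.
  rewrite (bigID (fun u : 'I_n => (u < v)%N)) /=.
  congr (_ + _); apply: eq_bigl => u; rewrite -andbA; congr (_ && _);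
    by rewrite -(inj_eq val_inj) /=; case: ltngtP.
rewrite [X in _ + X](exchange_big_dep (mem F)) /=; last by move=> ? ? _ /andP[].
apply/eqP; rewrite addr_eq0 -sumrN; apply/eqP; apply: eq_bigr => v vF.
rewrite -sumrN; apply: eq_big => [u|u /andP[uF uv]]; first by rewrite vF.
exact: eC.
Qed.

(* The argument k is the number of vertices, so that the m-chains are
   [chains K m.+1] and the (-1)-chains are [chains K 0]. *)
Definition chains K (k : nat) : {vspace chain} :=
  <<[seq face_chain F | F in [set F in K | #|F| == k]%SET]>>%VS.

Definition cycles K (m : nat) : {vspace chain} :=
  (chains K m.+1 :&: lker boundary)%VS.

Definition boundaries K (m : nat) : {vspace chain} :=
  (boundary @: chains K m.+2)%VS.

Fact boundaries_sub_cycles K m : is_complex K ->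
  (boundaries K m <= cycles K m)%VS.
Proof.
move=> [_ Kcl]; rewrite /boundaries /chains limg_span.
apply/span_subvP => b /mapP[c cK ->{b}].
have /fintype.imageP[F + ->] := cK; rewrite !inE => /andP[FK /eqP Fm].
rewrite memv_cap memv_ker boundary_face_chain boundaryK eqxx andbT.
apply: memv_suml => v vF; apply/memvZ/memv_span/fintype.image_f.
rewrite !inE (Kcl F) ?subD1set //=.
by move: Fm; rewrite (cardsD1 v) vF add1n => -[->].
Qed.

(* Dimension of the quotient cycles / boundaries when [is_complex K]. *)
Definition reduced_betti K (m : nat) : nat :=
  (\dim (cycles K m) - \dim (boundaries K m))%N.

End SimplicialHomology.

Section QuotaComplex.
Variables (R : realType) (n : nat).

Definition quota_complex (w : 'I_n -> R) (q : R) : {set {set 'I_n}} :=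
  [set F : {set 'I_n} | \sum_(v in F) w v < q]%SET.

Fact quota_complexP (w : 'I_n -> R) (q : R) :
  (forall v, 0 < w v) -> 0 < q -> is_complex (quota_complex w q).
Proof.
move=> w0 q0; split=> [|F G]; first by rewrite inE big_set0.
rewrite !inE => wF GF; apply: le_lt_trans wF.
rewrite [leRHS](big_setID G) /= (finset.setIidPr GF) lerDl.
by apply: sumr_ge0 => v _; exact: ltW.
Qed.

End QuotaComplex.

Section Probability.
Variables (d : measure_display) (T : measurableType d) (R : realType).
Variables (P : probability T R) (N : nat).

Definition mutually_independent (X : 'I_N -> {RV P >-> R}) :=
  forall A : 'I_N -> set R, (forall j, measurable (A j)) ->
  forall J : {set 'I_N},
    P (\bigcap_(j in [set` J]) (X j @^-1` A j))%classic =
    (\prod_(j in J) P (X j @^-1` A j)%classic)%E.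

(* The X j are {0, 1}-valued almost surely; on the null set where they are not,
   the weights below may fail to be positive, which no expectation sees. *)
Definition iid_bernoulli (p : R) (X : 'I_N -> {RV P >-> R}) :=
  mutually_independent X /\
  (forall j, P (X j @^-1` [set 1])%classic = p%:E /\
             P (X j @^-1` [set 0])%classic = (1 - p)%:E).

(* Vertex 0 of 'I_N.+1 has weight 1; the random variable indexed by j : 'I_N
   sits at vertex [lift ord0 j], i.e., vertex number j + 1. *)
Definition bernoulli_weight (X : 'I_N -> {RV P >-> R}) (t : T)
    (v : 'I_N.+1) : R :=
  if unlift ord0 v is Some j then 1 + X j t else 1.

Definition bernoulli_quota_complex (X : 'I_N -> {RV P >-> R}) (q : nat)
    (t : T) : {set {set 'I_N.+1}} :=
  quota_complex (bernoulli_weight X t) q%:R.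

Definition expected_betti (X : 'I_N -> {RV P >-> R}) (q m : nat) : \bar R :=
  ('E_P[fun t => (reduced_betti R (bernoulli_quota_complex X q t) m)%:R])%E.

End Probability.

Definition unimodal (disp : Order.disp_t) (T : porderType disp)
    (u : nat -> T) :=
  exists k : nat,
    (forall i j : nat, (i <= j <= k)%N -> (u i <= u j)%O) /\
    (forall i j : nat, (k <= i <= j)%N -> (u j <= u i)%O).

(* Main.v *)
Require Import Defs.
From mathcomp Require Import all_boot all_order all_algebra.
From mathcomp Require Import all_classical all_reals all_analysis.
From mathcomp Require Import measurable_realfun.
From mathcomp Require Import zify ring.

(* Vertex 0 has minimal weight, so every facet of a face F avoiding it can be
   coned off to vertex 0. The homology is therefore carried by the faces F that
   avoid vertex 0 and cannot be coned off themselves; as the weights are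
   integers, these are the F of weight exactly q - 1. A face with k vertices has
   this weight when q - 1 - k of them have weight 2, hence, with k = m + 1 and
   Q = q - 1,
     E[beta_m] = C(N, k) C(k, Q - k) p^(Q - k) (1 - p)^(2k - Q).
   The ratio of consecutive terms,
     (1 - p)^2 (N - k) (Q - k) / (p (2k + 2 - Q) (2k + 1 - Q)),
   is nonincreasing in k, which gives unimodality. *)

Set Implicit Arguments.
Unset Strict Implicit.
Unset Printing Implicit Defensive.

Import Order.TTheory GRing.Theory Num.Theory.
Local Open Scope ring_scope.

(** * Reduced Betti numbers of a complex that can be coned off to vertex 0 *)

Section BettiCone.
Variables (R : realType) (n : nat).
Implicit Types (F G : {set 'I_n.+1}) (K : {set {set 'I_n.+1}}).

(** Evaluations at the sets [g j] act as dual functionals: if [h i] were a combination of the other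
    members, evaluating at [g i] would give 1 = 0. *)
Lemma free_map_dual (I : eqType) (h : I -> chain R n.+1)
    (g : I -> {set 'I_n.+1}) (s : seq I) : uniq s ->
  {in s &, forall i j, h i (g j) = (i == j)%:R} -> free (map h s).
Proof.
elim: s => [|i s IHs] /=; first by rewrite nil_free.
move=> /andP[iNs us] hg; rewrite free_cons IHs // ?andbT; last first.
  by move=> j k js ks; apply: hg; rewrite inE ?js ?ks orbT.
apply/negP => /(@coord_span _ _ _ (in_tuple (map h s))) hi.
have /eqP := hg i i (mem_head _ _) (mem_head _ _).
rewrite hi sum_ffunE eqxx big1 ?(eq_sym 0) ?oner_eq0 // => k _.
rewrite ffunE; have : (in_tuple (map h s))`_k \in map h s by rewrite mem_nth.
move=> /mapP[j js ->]; rewrite hg ?inE ?eqxx ?js ?orbT //.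
have -> : (j == i) = false by apply: contraNF iNs => /eqP <-.
by rewrite scaler0.
Qed.

Lemma dim_span_dual (S : {set {set 'I_n.+1}})
    (h : {set 'I_n.+1} -> chain R n.+1)
    (g : {set 'I_n.+1} -> {set 'I_n.+1}) :
  {in S &, forall F G, h F (g G) = (F == G)%:R} ->
  \dim <<[seq h F | F in S]>> = #|S|.
Proof.
move=> hg; have /eqP -> : free [seq h F | F in S].
  apply: (free_map_dual (g := g)); first exact: enum_uniq.
  by move=> F G; rewrite !mem_enum => FS GS; exact: hg.
by rewrite size_map -cardE.
Qed.

Lemma dim_chains K k : \dim (chains R K k) = #|[set F in K | #|F| == k]%SET|.
Proof.
by apply: (dim_span_dual (g := id)) => F G _ _; rewrite ffunE eq_sym.
Qed.

Definition star_faces K k : {set {set 'I_n.+1}} :=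
  [set F in K | (#|F| == k) && (ord0 \in F)]%SET.

(** The only facet of [F] that avoids [ord0] is [F :\ ord0], and its sign is +1 because [ord0] comes
    first in the orientation. This is the duality that makes the boundaries of star faces linearly
    independent. *)
Lemma boundary_face_star F G : ord0 \in F -> ord0 \in G ->
  boundary_face R F (G :\ ord0) = (F == G)%:R.
Proof.
move=> F0 G0; rewrite sum_ffunE (bigD1 ord0) //= big1 ?addr0.
  rewrite !ffunE.
  have -> : [set u in F | (u < @ord0 n)%N]%SET = finset.set0.
    by apply/finset.setP => u; rewrite !inE ltn0 andbF.
  rewrite cards0 expr0 scale1r; congr (_%:R); congr (nat_of_bool _).
  apply/eqP/eqP => [FG|->//].
  by rewrite -(finset.setD1K F0) -(finset.setD1K G0) FG.
move=> v /andP[vF v0]; rewrite !ffunE.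
case: eqP => [FG|]; last by rewrite scaler0.
have : ord0 \in F :\ v by rewrite !inE eq_sym v0.
by rewrite -FG !inE eqxx.
Qed.

(* Expanding [d (d (ord0 |: F)) = 0] expresses [d F] through the boundaries of
   star faces, even when [ord0 |: F] is not a face of [K]. *)
Lemma boundary_chains_star K k :
  (forall F v, F \in K -> v \in F -> ord0 \notin F ->
    ord0 |: (F :\ v) \in K) ->
  (boundary R n.+1 @: chains R K k.+1)%VS =
  <<[seq boundary_face R F | F in star_faces K k.+1]>>%VS.
Proof.
move=> Kcone; apply/eqP; rewrite eqEsubv; apply/andP; split; last first.
  apply/span_subvP => c /fintype.imageP[F + ->]; rewrite !inE => /and3P[FK Fk _].
  rewrite -boundary_face_chain; apply/memv_img/memv_span/fintype.image_f.
  by rewrite !inE FK.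
rewrite /chains limg_span; apply/span_subvP => b /mapP[c].
move=> /fintype.imageP[F + ->] ->; rewrite !inE => /andP[FK Fk].
rewrite boundary_face_chain.
have [F0|F0] := boolP (ord0 \in F).
  by apply/memv_span/fintype.image_f; rewrite !inE FK Fk.
have := boundaryK R (ord0 |: F).
rewrite /boundary_face big_setU1 //= linearD linearZ /=.
rewrite -/(boundary_face R F) boundary_face_chain finset.setU1K //.
have -> : [set u in (ord0 |: F) | (u < @ord0 n)%N]%SET = finset.set0.
  by apply/finset.setP => u; rewrite !inE ltn0 andbF.
rewrite cards0 expr0 scale1r => /eqP; rewrite addr_eq0 => /eqP ->.
rewrite memvN linear_sum; apply: memv_suml => v vF.
rewrite linearZ /= boundary_face_chain; apply: memvZ.
have v0 : v != ord0 by apply: contraNneq F0 => <-.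
have -> : (ord0 |: F) :\ v = ord0 |: (F :\ v).
  apply/finset.setP => u; rewrite !inE; case: (eqVneq u v) => [->|] //=.
  by rewrite (negPf v0).
apply/memv_span/fintype.image_f; rewrite finset.in_set Kcone //.
rewrite setU11 cardsU1 !inE.
by move: Fk; rewrite (negPf F0) andbF (cardsD1 v) vF /= andbT.
Qed.

(** The rank of the boundary in each degree is the number of star faces, so rank-nullity reduces the
    Betti number to a count: all faces with [m.+1] vertices, minus the star faces with [m.+1] and
    with [m.+2] vertices. Deleting [ord0] matches the latter with the faces that can be coned
    off. *)
Lemma reduced_betti_cone K m : is_complex K ->
  (forall F v, F \in K -> v \in F -> ord0 \notin F ->
    ord0 |: (F :\ v) \in K) ->
  reduced_betti R K m =
  #|[set F in K | [&& #|F| == m.+1, ord0 \notin F & ord0 |: F \notin K]]%SET|.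
Proof.
move=> [_ Kcl] Kcone.
have rank k : \dim (boundary R n.+1 @: chains R K k.+1) = #|star_faces K k.+1|.
  rewrite boundary_chains_star // (dim_span_dual (g := fun G => G :\ ord0)) //.
  move=> F G; rewrite !inE => /and3P[_ _ F0] /and3P[_ _ G0].
  exact: boundary_face_star.
have := limg_ker_dim (boundary R n.+1) (chains R K m.+1).
rewrite rank dim_chains /reduced_betti /boundaries rank /cycles => dimZ.
pose L := [set F in K | [&& #|F| == m.+1, ord0 \notin F & ord0 |: F \in K]]%SET.
have cardL : #|star_faces K m.+2| = #|L|.
  have -> : star_faces K m.+2 = [set ord0 |: F | F in L].
    apply/finset.setP => G; apply/idP/imsetP => [|[F + ->]].
      rewrite inE => /and3P[GK Gm G0]; exists (G :\ ord0);
        last by rewrite finset.setD1K.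
      rewrite !inE finset.setD1K // GK eqxx (Kcl G) ?subD1set //= andbT.
      by move: Gm; rewrite (cardsD1 ord0) G0.
    rewrite finset.in_set => /and4P[_ /eqP Fm F0 FK].
    by rewrite finset.in_set FK setU11 cardsU1 F0 Fm eqxx.
  rewrite card_in_imset // => F G; rewrite !inE => /and4P[_ _ F0 _].
  move=> /and4P[_ _ G0 _] FG.
  by rewrite -(finset.setU1K F0) -(finset.setU1K G0) FG.
set B := [set F in K | _]%SET.
(* Each face contains [ord0], or avoids it and can be coned off ([L]), or avoids it and cannot
   ([B]). *)
have cardC : #|[set F in K | #|F| == m.+1]%SET| =
    (#|star_faces K m.+1| + (#|L| + #|B|))%N.
  rewrite -(cardsID (star_faces K m.+1)); congr (_ + _)%N.
    by apply: eq_card => F; rewrite !inE; case: (F \in K); case: (_ == _);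
      case: (ord0 \in F).
  rewrite -(cardsID L); congr (_ + _)%N; apply: eq_card => F; rewrite !inE;
    by case: (F \in K); case: (_ == _); case: (ord0 \in F); case: (_ \in K).
rewrite cardL; move: dimZ; rewrite cardC => /eqP.
by rewrite addnC eqn_add2l => /eqP ->; rewrite addKn.
Qed.

End BettiCone.

(** * Unimodality from ratios of consecutive terms, applied to the closed formula *)

Lemma unimodal_step (disp : Order.disp_t) (T : porderType disp) (u : nat -> T)
    (k : nat) :
  (forall i, (i < k)%N -> (u i <= u i.+1)%O) ->
  (forall i, (k <= i)%N -> (u i.+1 <= u i)%O) -> unimodal u.
Proof.
move=> incr decr; exists k; split=> i j /andP[].
  move=> ij; rewrite -(subnKC ij); elim: (j - i)%N => [|l IHl] lk.
    by rewrite addn0.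
  rewrite addnS in lk *; apply: le_trans (IHl (ltnW lk)) _; exact: incr.
move=> ki ij; rewrite -(subnKC ij); elim: (j - i)%N => [|l IHl].
  by rewrite addn0.
rewrite addnS; apply: le_trans IHl; apply: decr.
by rewrite (leq_trans ki) ?leq_addr.
Qed.

(** The ratio [alpha k / beta k] is kept in product form because [beta] may vanish. The condition
    [D], that the ratio is defined and at most 1, persists once it holds, so the first index
    satisfying it is a peak. *)
Lemma unimodal_ratio (R : realType) (u alpha beta : nat -> R) :
  (forall k, 0 <= u k) -> (forall k, 0 <= beta k) ->
  (forall k, u k.+1 * beta k = u k * alpha k) ->
  (forall k, beta k = 0 -> u k = 0) ->
  (forall k, alpha k.+1 <= alpha k) ->
  (forall k, beta k <= beta k.+1) ->
  (exists k, (0 < beta k) && (alpha k <= beta k)) ->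
  unimodal u.
Proof.
move=> u0 b0 ub bu alphaS betaS Dex.
pose D k := (0 < beta k) && (alpha k <= beta k).
have DS k : D k -> D k.+1.
  move=> /andP[bk abk]; apply/andP; split; first exact: lt_le_trans (betaS k).
  exact: le_trans (le_trans (alphaS k) abk) (betaS k).
have [k Dk kmin] := ex_minnP Dex.
apply: (@unimodal_step _ _ _ k) => i.
  (* By contraposition: a strict descent at [i] forces [D i], hence [k <= i]. *)
  rewrite ltnNge; apply: contraR => uN; apply: kmin.
  have [bi|bi] := eqVneq (beta i) 0; first by rewrite bu // u0 in uN.
  have bi0 : 0 < beta i by rewrite lt_def bi b0.
  rewrite /D bi0 leNgt; apply: contra uN => /ltW bai.
  by rewrite -(ler_pM2r bi0) ub ler_wpM2l.
move=> /subnKC <-; set l := (i - k)%N.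
have /andP[bi abi] : D (k + l)%N.
  by elim: l => [|l IHl]; rewrite ?addn0 // addnS DS.
by rewrite -(ler_pM2r bi) ub ler_wpM2l.
Qed.

(* [Q] stands for [q - 1] and [k] for the number of vertices of a face. *)
Definition mean_betti (R : realType) (p : R) (N Q k : nat) : R :=
  if (k <= Q)%N then
    ('C(N, k) * 'C(k, Q - k))%:R * (p ^+ (Q - k) * (1 - p) ^+ (k - (Q - k)))
  else 0.

(** Even with weight 2 on all its [k] vertices, a face cannot reach weight [Q]. *)
Lemma mean_betti_eq0 (R : realType) (p : R) (N Q k : nat) :
  (k.*2 < Q)%N -> mean_betti p N Q k = 0.
Proof.
move=> kQ; rewrite /mean_betti; case: ifP => // _.
by rewrite (@bin_small k) ?muln0 ?mul0r //; lia.
Qed.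

(** With [a = Q - k.+1], three absorption identities combine: ['C(k.+1, a)] to ['C(k, a)], then
    ['C(k, a)] to ['C(k, a.+1)], and ['C(N, k.+1)] to ['C(N, k)]; the factor [k.+1] passes from the
    first to the last. *)
Lemma bin_bin_ratio (N Q k : nat) : (k < Q)%N ->
  ('C(N, k.+1) * 'C(k.+1, Q - k.+1) * ((k.*2.+2 - Q) * (k.*2.+1 - Q)) =
   'C(N, k) * 'C(k, Q - k) * ((N - k) * (Q - k)))%N.
Proof.
move=> kQ; have [a ->] : exists a, (Q = k.+1 + a)%N by exists (Q - k.+1)%N; lia.
have -> : (k.+1 + a - k.+1 = a)%N by lia.
have -> : (k.+1 + a - k = a.+1)%N by lia.
have -> : (k.*2.+2 - (k.+1 + a) = k.+1 - a)%N by lia.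
have -> : (k.*2.+1 - (k.+1 + a) = k - a)%N by lia.
have h1 := mul_bin_left N k; have h2 := mul_bin_down k.+1 a.
have h3 := mul_bin_left k a; rewrite /= in h2.
transitivity ('C(N, k.+1) * (((k.+1 - a) * 'C(k.+1, a)) * (k - a)))%N.
  by ring.
rewrite -h2 -mulnA [('C(k, a) * _)%N]mulnC -h3 mulnA.
rewrite [('C(N, k.+1) * _)%N]mulnC h1.
by ring.
Qed.

Lemma mean_betti_ratio (R : realType) (p : R) (N Q k : nat) :
  mean_betti p N Q k.+1 * (p * ((k.*2.+2 - Q) * (k.*2.+1 - Q))%:R) =
  mean_betti p N Q k * ((1 - p) ^+ 2 * ((N - k) * (Q - k))%:R).
Proof.
have [kQ|Qk] := ltnP k Q; last first.
  (* For [Q <= k] both sides vanish: the left by the guard in [mean_betti], the right because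
     [Q - k] truncates to 0. *)
  by rewrite {1}/mean_betti leqNgt ltnS Qk mul0r (eqP Qk) muln0 !mulr0.
have [Qk2|kQ2] := leqP Q k.*2; last first.
  rewrite (@mean_betti_eq0 _ _ _ _ k) // mul0r.
  by have -> : (k.*2.+1 - Q = 0)%N; [lia|rewrite muln0 !mulr0].
rewrite /mean_betti kQ (ltnW kQ).
set T1 := (_ * _)%N; set S1 := (_ * _)%N;
set T2 := (_ * _)%N; set S2 := (_ * _)%N.
have E : (T1%:R * S1%:R = T2%:R * S2%:R :> R) by rewrite -!natrM bin_bin_ratio.
have -> : (Q - k = (Q - k.+1).+1)%N by lia.
(* One more vertex at the same total weight means one vertex of weight 2 fewer and two of weight 1
   more. *)
have -> : (k.+1 - (Q - k.+1) = (k - (Q - k.+1).+1) + 2)%N by lia.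
rewrite exprD [p ^+ _.+1]exprS;
set x := p ^+ _; set y := _ ^+ (_ - _); set z := _ ^+ 2.
transitivity (T1%:R * S1%:R * (p * x * y * z)); first by ring.
by rewrite E; ring.
Qed.

Lemma unimodal_mean_betti (R : realType) (p : R) (N Q : nat) :
  0 < p -> p < 1 -> unimodal (fun m => mean_betti p N Q m.+1).
Proof.
move=> p0 p1.
have q0 : 0 <= 1 - p by rewrite subr_ge0 ltW.
apply: (@unimodal_ratio _ _
  (fun m => (1 - p) ^+ 2 * ((N - m.+1) * (Q - m.+1))%:R)
  (fun m => p * ((m.+1.*2.+2 - Q) * (m.+1.*2.+1 - Q))%:R)).
- move=> m; rewrite /mean_betti; case: ifP => // _.
  by rewrite !mulr_ge0 // exprn_ge0 // ltW.
- by move=> m; rewrite mulr_ge0 // ltW.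
- by move=> m; exact: mean_betti_ratio.
- move=> m /eqP; rewrite mulf_eq0 gt_eqF //= pnatr_eq0 => mQ.
  by apply: mean_betti_eq0; lia.
- by move=> m; rewrite ler_wpM2l ?exprn_ge0 // ler_nat leq_mul //; lia.
- by move=> m; rewrite ler_wpM2l ?(ltW p0) // ler_nat leq_mul //; lia.
(* At index [Q] the face size is [Q.+1], so truncation makes [alpha] zero while [beta] is
   positive. *)
- exists Q; rewrite mulr_gt0 //=; last by rewrite ltr0n; nia.
  have -> : (Q - Q.+1 = 0)%N by lia.
  by rewrite muln0 mulr0 mulr_ge0 // ltW.
Qed.

(** * Betti numbers of quota complexes with a lightest vertex, then with weights 1 and 2 *)

Section QuotaBetti.
Variables (R : realType) (n : nat) (w : 'I_n.+1 -> R) (q : R).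
Hypotheses (w_gt0 : forall v, 0 < w v) (w_min : forall v, w ord0 <= w v).

(** Exchanging a vertex for the lightest one, [ord0], cannot raise the weight; this is the coning
    hypothesis of [reduced_betti_cone]. *)
Lemma quota_betti m : 0 < q ->
  reduced_betti R (quota_complex w q) m =
  #|[set F : {set 'I_n.+1} | [&& #|F| == m.+1, ord0 \notin F,
      \sum_(v in F) w v < q & q <= w ord0 + \sum_(v in F) w v]]%SET|.
Proof.
move=> q0; rewrite reduced_betti_cone; first 1 last.
- exact: quota_complexP.
- move=> F v; rewrite !finset.in_set => Fq vF F0.
  rewrite big_setU1 /=; last by rewrite !inE (negPf F0) andbF.
  apply: le_lt_trans Fq; rewrite [leRHS](big_setD1 v) //=.
  by rewrite lerD2r.
apply: eq_card => F; rewrite !finset.in_set.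
have [F0|F0] := boolP (ord0 \in F); first by rewrite /= !andbF.
rewrite big_setU1 //= -leNgt.
by case: (#|F| == _); rewrite ?andbF.
Qed.

End QuotaBetti.

(* A pair [(F, A)] records a face together with its vertices of weight 2. *)
Definition marked_faces N (k Q : nat) : {set {set 'I_N} * {set 'I_N}} :=
  [set FA : {set 'I_N} * {set 'I_N} | [&& FA.2 \subset FA.1, #|FA.1| == k
    & (#|FA.1| + #|FA.2| == Q)%N]]%SET.

Lemma card_marked_faces N k Q :
  #|marked_faces N k Q| =
  if (k <= Q)%N then ('C(N, k) * 'C(k, Q - k))%N else 0%N.
Proof.
rewrite -sum1_card; under eq_bigl do rewrite finset.in_set.
(* For [Q < k] no pair exists, although the truncated [Q - k] would make the product equal to
   ['C(N, k)]. *)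
case: leqP => [kQ|Qk]; last by rewrite big1 // => -[F A] /= /and3P[_ /eqP]; lia.
transitivity (\sum_(F : {set 'I_N} | #|F| == k)
    \sum_(A : {set 'I_N} | (A \subset F) && (#|A| == Q - k)) 1)%N.
  rewrite pair_big_dep /=; apply: eq_bigl => -[F A] /=.
  rewrite andbCA; case: eqP => //= Fk; congr (_ && _).
  by apply/idP/idP; lia.
transitivity (\sum_(F : {set 'I_N} | #|F| == k) 'C(k, Q - k))%N.
  apply: eq_bigr => F /eqP Fk; rewrite -[X in 'C(X, _)]Fk -cards_draws -sum1_card.
  by apply: eq_bigl => A; rewrite finset.in_set.
rewrite sum_nat_const; congr (_ * _)%N.
rewrite -[in RHS](card_ord N) -card_draws; apply: eq_card => F.
by rewrite finset.in_set.
Qed.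

Section BernoulliWeights.
Variables (R : realType) (N : nat) (x : 'I_N -> R).
Hypothesis x01 : forall j, x j = 0 \/ x j = 1.

Let w (v : 'I_N.+1) : R := if unlift ord0 v is Some j then 1 + x j else 1.

Let w_ge1 v : 1 <= w v.
Proof.
by rewrite /w; case: unlift => // j; case: (x01 j) => ->; rewrite ?addr0 // lerDl.
Qed.

Let sum_w (F A : {set 'I_N}) : A \subset F ->
  {in F, forall j, x j = (j \in A)%:R} ->
  \sum_(v in lift ord0 @: F) w v = (#|F| + #|A|)%:R.
Proof.
move=> AF xA; rewrite big_imset /=; last by move=> ? ? _ _; exact: lift_inj.
under eq_bigr => j jF do rewrite /w liftK xA //.
rewrite big_split /= sumr_const natrD; congr (_ + _).
rewrite -natr_sum; congr (_%:R); rewrite -big_mkcondr /= -sum1_card.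
apply: eq_bigl => j; rewrite andbC.
by case: (boolP (j \in A)) => // /(fintype.subsetP AF) ->.
Qed.

(** Marking the vertices of weight 2 makes the index set [marked_faces] independent of [x]; only the
    compatibility test depends on it. The Betti number thus becomes a sum of indicators over a fixed
    set, ready for linearity of expectation. *)
Lemma bernoulli_quota_betti q m : (0 < q)%N ->
  reduced_betti R (quota_complex w q%:R) m =
  #|[set FA in marked_faces N m.+1 q.-1 |
      [forall j in FA.1, x j == (j \in FA.2)%:R]]%SET|.
Proof.
move=> q0; have w0 : w ord0 = 1 by rewrite /w unlift_none.
rewrite quota_betti ?ltr0n //; first last.
- by move=> v; rewrite w0.
- by move=> v; apply: lt_le_trans (w_ge1 v).
set D := [set FA in _ | _]%SET; set B := [set F | _]%SET.
have DP FA : FA \in D -> [/\ FA.2 \subset FA.1, #|FA.1| = m.+1,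
    (#|FA.1| + #|FA.2| = q.-1)%N & {in FA.1, forall j, x j = (j \in FA.2)%:R}].
  rewrite 2!finset.in_set => /andP[/and3P[-> /eqP-> /eqP->]] /forall_inP xA.
  by split=> // j jF; apply/eqP/xA.
have -> : B = [set lift ord0 @: FA.1 | FA : {set 'I_N} * {set 'I_N} in D].
  apply/finset.setP => G; apply/idP/imsetP => [|[FA /DP[AF Fm FAq xA] ->]].
    rewrite finset.in_set => /and4P[Gm G0 Gq qG].
    pose F := lift ord0 @^-1: G; pose A := [set j in F | x j == 1]%SET.
    have GF : G = lift ord0 @: F.
      apply/finset.setP => v; apply/idP/imsetP => [vG|[j]]; last first.
        by rewrite finset.in_set => jG ->.
      have [j vE|v0] := unliftP ord0 v; last by rewrite -v0 vG in G0.
      by exists j => //; rewrite finset.in_set -vE.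
    have AF : A \subset F by apply/fintype.subsetP => j; rewrite inE => /andP[].
    have xA : {in F, forall j, x j = (j \in A)%:R}.
      move=> j jF; rewrite finset.in_set jF.
      by case: (x01 j) => ->; rewrite ?eqxx // eq_sym oner_eq0.
    exists (F, A) => //=; rewrite 2!finset.in_set /= AF.
    have Fm : #|F| = m.+1.
      by rewrite -(eqP Gm) GF card_imset //; exact: lift_inj.
    (* The weight is now a natural number, so the two bounds pin it to [q.-1]. *)
    move: Gq qG; rewrite GF (sum_w AF xA) w0 nat1r ltr_nat ler_nat => Gq qG.
    rewrite Fm eqxx /= in Gq qG *; apply/andP; split; first by apply/eqP; lia.
    by apply/forall_inP => j jF; rewrite xA.
  rewrite finset.in_set (sum_w AF xA) w0 nat1r ltr_nat ler_nat FAq.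
  rewrite card_imset ?Fm ?eqxx /=; last exact: lift_inj.
  rewrite prednK // leqnn !andbT.
  by apply/imsetP => -[j _ /eqP]; rewrite (negPf (neq_lift _ _)).
rewrite card_in_imset // => -[F A] [F' A'] /DP[/= AF _ _ xA] /DP[/= AF' _ _ xA'].
move=> /(imset_inj lift_inj) FF'; rewrite -{F'}FF' in AF' xA' *; congr (_, _).
(* The marking is forced by [x] on [F] and is empty outside [F]. *)
apply/finset.setP => j; have [jF|jF] := boolP (j \in F).
  by have := xA j jF; rewrite xA' // => /eqP; rewrite eqr_nat; do 2 case: (_ \in _).
by apply/idP/idP => [/(fintype.subsetP AF)|/(fintype.subsetP AF')];
  rewrite (negPf jF).
Qed.
End BernoulliWeights.

(** * Measurability and expectation of the random Betti numbers *)

Section ExpectedBetti.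
Variables (disp : measure_display) (T : measurableType disp) (R : realType).
Variables (P : probability T R) (N : nat) (X : 'I_N -> {RV P >-> R}).

Lemma measurable_fun_fin (I : finType) (K : T -> I) (h : I -> R) :
  (forall i, measurable (K @^-1` [set i])%classic) ->
  measurable_fun setT (fun t => h (K t)).
Proof.
move=> mK _ Y mY; rewrite setTI.
have -> : ((fun t => h (K t)) @^-1` Y =
    \bigcup_(i in [set i | Y (h i)]) (K @^-1` [set i]))%classic.
  apply/seteqP; split=> [t Yt|t [i Yi Kt]]; first by exists (K t).
  by rewrite /preimage /= Kt.
by apply: fin_bigcup_measurable => // i _; exact: mK.
Qed.

Lemma measurable_bernoulli_weight v :
  measurable_fun setT (fun t => bernoulli_weight X t v).
Proof.
rewrite /bernoulli_weight; case: unlift => [j|]; last exact: measurable_cst.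
exact: measurable_funD.
Qed.

(** The random complex takes finitely many values, and each value is prescribed by finitely many
    comparisons of a measurable weight sum with [q]. *)
Lemma measurable_betti q m : measurable_fun setT
  (fun t => (reduced_betti R (bernoulli_quota_complex X q t) m)%:R : R).
Proof.
apply: (measurable_fun_fin (fun K => (reduced_betti R K m)%:R)) => K.
have -> : (bernoulli_quota_complex X q @^-1` [set K] =
    \bigcap_(F in @setT {set 'I_N.+1})
      ((fun t => \sum_(v in F) bernoulli_weight X t v < q%:R) @^-1` [set F \in K]))%classic.
  apply/seteqP; split=> [t <- F _ /=|t tK /=]; first by rewrite finset.in_set.
  by apply/finset.setP => F; rewrite finset.in_set; exact: (tK F).
apply: fin_bigcap_measurable => // F _; rewrite -[X in measurable X]setTI.
apply: measurable_fun_ltr => //.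
under eq_fun do rewrite -big_enum.
by apply: measurable_sum => v; exact: measurable_bernoulli_weight.
Qed.

Variable p : R.
Hypothesis X_iid : iid_bernoulli p X.

Definition marked_event (FA : {set 'I_N} * {set 'I_N}) : set T :=
  (\bigcap_(j in [set` FA.1]) (X j @^-1` [set (j \in FA.2)%:R]))%classic.

Lemma measurable_marked_event FA : measurable (marked_event FA).
Proof.
by apply: fin_bigcap_measurable => // j _; exact: measurable_funPTI.
Qed.

Lemma prob_marked_event (F A : {set 'I_N}) : A \subset F ->
  P (marked_event (F, A)) = (p ^+ #|A| * (1 - p) ^+ (#|F| - #|A|))%:E.
Proof.
case: X_iid => indep law AF; rewrite /marked_event indep //=.
transitivity ((\prod_(j in F) (if j \in A then p else 1 - p)%:E)%E).
  apply: eq_bigr => j _; case: (j \in A) => /=; first by case: (law j).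
  by case: (law j).
rewrite prodEFin; congr (_%:E).
rewrite (big_setID A) /= (finset.setIidPr AF); congr (_ * _).
  by rewrite (eq_bigr (fun=> p)) ?prodr_const // => j ->.
rewrite (eq_bigr (fun=> 1 - p)) ?prodr_const ?cardsDS //.
by move=> j; rewrite finset.in_setD => /andP[/negPf ->].
Qed.

(** The disjoint events of values 0 and 1 have total probability [(1 - p) + p = 1]. *)
Lemma ae_bernoulli : \forall t \ae P, forall j, X j t = 0 \/ X j t = 1.
Proof.
apply: filter_forall => j; have [_ /(_ j)[P1 P0]] := X_iid.
pose B b := (X j @^-1` [set b])%classic.
have mB b : measurable (B b).
  exact: measurable_funPTI.
exists (~` (B 0 `|` B 1))%classic; split.
- by apply: measurableC; exact: measurableU.
- rewrite probability_setC; last exact: measurableU.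
  have -> : P (B 0 `|` B 1)%classic = (P (B 0%R) + P (B 1%R))%E.
    apply: measureU => //.
    apply/seteqP; split=> // t [/= X0 X1].
    by have := oner_neq0 R; rewrite -X1 X0 eqxx.
  by rewrite /B P0 P1 -EFinD subrK subrr.
- by move=> t; apply: contra_not => -[]; [left|right].
Qed.

(** All marked faces have equal probability, since [m] and [q] fix both the size of the face and its
    number of marks; the expectation is this probability times the number of marked faces. *)
Lemma expected_bettiE q m : (0 < q)%N ->
  expected_betti X q m = (mean_betti p N q.-1 m.+1)%:E.
Proof.
move=> q0; pose S := marked_faces N m.+1 q.-1.
transitivity (\int[P]_t \sum_(FA <- enum S) (\1_(marked_event FA) t)%:E)%E.
  (* The indicator formula holds only where every [X j] is 0 or 1, hence almost everywhere. *)
  rewrite /expected_betti unlock; apply: ae_eq_integral => //.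
  - by apply/measurable_EFinP; exact: measurable_betti.
  - apply: emeasurable_sum => FA; apply/measurable_EFinP.
    exact/measurable_indicP/measurable_marked_event.
  - apply: filterS ae_bernoulli => t Xt _ /=.
    rewrite sumEFin; congr (_%:E).
    rewrite /bernoulli_quota_complex (bernoulli_quota_betti Xt) //.
    rewrite -sum1_card natr_sum big_enum /=.
    rewrite big_mkcond [RHS]big_mkcond /=; apply: eq_bigr => FA _.
    rewrite finset.in_set; case: (FA \in S) => //=.
    rewrite indicE; case: ifPn => [/forall_inP xA|xA].
      by rewrite mem_set // => j /= jF; apply/eqP/xA.
    rewrite memNset // => tE; move/negP: xA; apply; apply/forall_inP => j jF.
    by apply/eqP/tE.
rewrite ge0_integral_sum //; last first.
  move=> FA; apply/measurable_EFinP.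
  exact/measurable_indicP/measurable_marked_event.
rewrite big_enum /=.
transitivity (\sum_(FA in S)
  (p ^+ (q.-1 - m.+1) * (1 - p) ^+ (m.+1 - (q.-1 - m.+1)))%:E)%E.
  apply: eq_bigr => -[F A]; rewrite finset.in_set /= => /and3P[AF /eqP Fm /eqP FA].
  have Ac : #|A| = (q.-1 - m.+1)%N by rewrite -FA Fm addKn.
  rewrite integral_indic //; last exact: measurable_marked_event.
  by rewrite setIT -[LHS]/(P (marked_event (F, A))) prob_marked_event // Fm Ac.
rewrite sumEFin sumr_const card_marked_faces /mean_betti; congr (_%:E).
by case: leqP => _; rewrite ?mulr0n ?mulr_natl.
Qed.

End ExpectedBetti.

Theorem theorem1p1 (R : realType) (disp : measure_display)
    (T : measurableType disp) (P : probability T R)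
    (q N : nat) (d p : R) (X : 'I_N -> {RV P >-> R})
    (q_gt0 : (0 < q)%N) (d_gt : 1 / 2 < d) (N_eq : N.+1%:R = d * q%:R)
    (p_gt0 : 0 < p) (p_lt1 : p < 1) (X_iid : iid_bernoulli p X) :
  unimodal (fun m : nat => expected_betti X q m).
Proof.
have [k [incr decr]] := unimodal_mean_betti N q.-1 p_gt0 p_lt1.
exists k; split=> i j ij; rewrite !(expected_bettiE X_iid) // lee_fin.
- exact: incr.
- exact: decr.
Qed.
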